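(* Assume that $\mathcal L$ is either the Fokker–Planck operator or the linear Boltzmann operator with a reversible kernel. Then for all (sufficiently regular) real-valued $f$, $$f_\infty\,\mathcal L\!\left(\frac{f^2}{f_\infty}\right)-2f\,\mathcal Lf\ge0.$$
   Context: $\mathsf V=\mathbb R^d$ with $M(v)=(2\pi)^{-d/2}e^{-|v|^2/2}$, or $\mathsf V=\mathbb S^{d-1}$ with $M(v)=|\mathbb S^{d-1}|^{-1}$; $f_\infty(x,v)=e^{-\phi(x)}M(v)$ for a potential $\phi=\phi(x)$, and $\mathcal L$ acts on the variable $v$ only. The Fokker–Planck operator is $\mathcal Lf=\Delta_{\mathrm{LB}}f$ (Laplace–Beltrami operator) if $\mathsf V=\mathbb S^{d-1}$ and $\mathcal Lf=\nabla_v\cdot(\nabla_vf+vf)$ if $\mathsf V=\mathbb R^d$. The linear Boltzmann operator is $\mathcal Lf(v)=\int_{\mathsf V}[k(v,v_* )f(v_* )-f(v)k(v_*,v)]\,\mathrm dv_*$ with $0\le k\in C^0(\mathsf V^2)$ having $M$ as its only invariant measure; the kernel is reversible if $k(v,v_* )M(v_* )=k(v_*,v)M(v)$ for all $v,v_*\in\mathsf V$. *)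

(* Defs.v *)
From HB Require Import structures.
From mathcomp Require Import all_boot all_order all_algebra.
From mathcomp Require Import all_classical all_reals all_analysis.
From mathcomp Require Import measurable_realfun.
Set Implicit Arguments.
Unset Strict Implicit.
Unset Printing Implicit Defensive.
Import Order.TTheory GRing.Theory Num.Theory.
Import numFieldNormedType.Exports.
Local Open Scope classical_set_scope.
Local Open Scope ring_scope.

(* A function on the velocity space V (R^d or the unit
   sphere of R^d) is represented by a function on the row vectors 'rV[R]_d of
   which only the values on V are ever used. *)

(* Row vectors carry the product sigma-algebra, generated by the coordinates
   exactly as the library does for tuples; it is the Borel sigma-algebra. *)
Definition measure_rV_display : measure_display -> measure_display.
Proof. exact. Qed.

Section measurable_rV.
Context {d} {T : measurableType d}.
Variable n : nat.

Let coors : 'I_n -> 'rV[T]_n -> T := fun i v => v ord0 i.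

Let rV_set0 : g_sigma_preimage coors set0.
Proof. exact: sigma_algebra0. Qed.

Let rV_setC A : g_sigma_preimage coors A -> g_sigma_preimage coors (~` A).
Proof. exact: sigma_algebraC. Qed.

Let rV_bigcup (F : (set 'rV[T]_n)^nat) :
  (forall i, g_sigma_preimage coors (F i)) ->
  g_sigma_preimage coors (\bigcup_i (F i)).
Proof. exact: sigma_algebra_bigcup. Qed.

HB.instance Definition _ := @isMeasurable.Build (measure_rV_display d)
  'rV[T]_n (g_sigma_preimage coors) rV_set0 rV_setC rV_bigcup.

End measurable_rV.

Section lebesgue_rV.
Context {R : realType}.
(* the Borel line on which the library defines [lebesgue_measure] *)
Local Notation mR := (measurableTypeR R).

Section lebesgue_cons.
Variables (n : nat) (mu : {sigma_finite_measure set (n.-tuple mR) -> \bar R}).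

Let prod_mu : {measure set (mR * n.-tuple mR)%type -> \bar R} :=
  product_measure1 lebesgue_measure mu.

Let consp (p : mR * n.-tuple mR) : n.+1.-tuple mR := [tuple of p.1 :: p.2].

Let measurable_consp : measurable_fun setT consp.
Proof. exact: measurable_cons. Qed.

Definition lebesgue_cons : set (n.+1.-tuple mR) -> \bar R :=
  pushforward prod_mu consp.

HB.instance Definition _ := Measure.copy lebesgue_cons
  (measure_function_pushforward__canonical__measure_function_Measure
    prod_mu measurable_consp).

Lemma lebesgue_cons_sigma_finite : sigma_finite setT lebesgue_cons.
Proof.
have /sigma_finiteP[F [TF ndF Foo]] := sigma_finiteT (@lebesgue_measure R).
have /sigma_finiteP[G [TG ndG Goo]] := sigma_finiteT mu.
pose g (t : n.+1.-tuple mR) : mR * n.-tuple mR := (thead t, [tuple of behead t]).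
have cK : cancel consp g.
  by move=> [x t]; rewrite /g /consp /= theadE; congr (_, _); apply/val_inj.
have mg : measurable_fun setT g.
  apply/measurable_fun_pairP; split; first exact: measurable_tnth.
  exact: measurable_behead.
exists (fun i => g @^-1` (F i `*` G i)).
  rewrite predeqE => t; split => // _.
  have [i _ Fi] : (\bigcup_i F i) (g t).1 by rewrite -TF.
  have [j _ Gj] : (\bigcup_i G i) (g t).2 by rewrite -TG.
  exists (maxn i j) => //; split.
  - by move: Fi; exact/subsetPset/ndF/leq_maxl.
  - by move: Gj; exact/subsetPset/ndG/leq_maxr.
move=> k; have [mFk Fkoo] := Foo k; have [mGk Gkoo] := Goo k.
have mFG : measurable (F k `*` G k) by exact: measurableX.
split; first by rewrite -[X in measurable X]setTI; exact: mg.
rewrite /lebesgue_cons /pushforward -comp_preimage.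
rewrite (_ : g \o consp = id) ?preimage_id; last exact/funext.
by rewrite /= product_measure1E// lte_mul_pinfty// ge0_fin_numE.
Qed.

HB.instance Definition _ := Measure_isSigmaFinite.Build _ _ _ lebesgue_cons
  lebesgue_cons_sigma_finite.

End lebesgue_cons.

Fixpoint lebesgue_tuple n : {sigma_finite_measure set (n.-tuple mR) -> \bar R} :=
  if n is m.+1 then lebesgue_cons (lebesgue_tuple m) else dirac [tuple].


Context {d : nat}.

Let rV_of_tuple (t : d.-tuple mR) : 'rV[R]_d := \row_i tnth t i.

Let measurable_rV_of_tuple : measurable_fun setT rV_of_tuple.
Proof.
apply: (@measurability _ _ _ _ _ _
  (\big[setU/set0]_(i < d) preimage_set_system setT
     (fun v : 'rV[R]_d => v ord0 i) measurable)) => //.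
move=> _ [A + <-]; rewrite -bigcup_seq => -[i _ [B mB <-]].
rewrite !setTI -comp_preimage.
rewrite (_ : _ \o _ = fun t => tnth t i); last first.
  by apply/funext => t /=; rewrite mxE.
by rewrite -[X in measurable X]setTI; exact: measurable_tnth.
Qed.

Definition lebesgue_rV : set 'rV[R]_d -> \bar R :=
  pushforward (lebesgue_tuple d) rV_of_tuple.

HB.instance Definition _ := Measure.copy lebesgue_rV
  (measure_function_pushforward__canonical__measure_function_Measure
    (lebesgue_tuple d) measurable_rV_of_tuple).

End lebesgue_rV.

Section sphere.
Context {R : realType}.
Context {d : nat}.
Implicit Types v w : 'rV[R]_d.

(* The library's norm on 'rV[R]_d is the sup norm. *)
Definition enorm v : R := Num.sqrt (\sum_i v ord0 i ^+ 2).

Definition sphere : set 'rV[R]_d := [set v | enorm v = 1].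

Definition normalize v : 'rV[R]_d := (enorm v)^-1 *: v.

Lemma measurable_coord_rV (i : 'I_d) :
  measurable_fun setT (fun v : 'rV[R]_d => v ord0 i).
Proof.
move=> _ Y mY; apply: sub_sigma_algebra; rewrite -bigcup_seq /=.
by exists i; [rewrite /= mem_index_enum|exists Y].
Qed.

Lemma measurable_enorm : measurable_fun setT enorm.
Proof.
apply: (@measurableT_comp _ _ _ _ _ _ (@Num.sqrt R)) => //.
  apply: continuous_measurable_fun; exact: sqrt_continuous.
apply: measurable_sum => i.
exact: measurable_funX (measurable_coord_rV i).
Qed.

Lemma measurable_normalize : measurable_fun setT normalize.
Proof.
apply: (@measurability _ _ _ _ _ _
  (\big[setU/set0]_(i < d) preimage_set_system setT
     (fun v : 'rV[R]_d => v ord0 i) measurable)) => //.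
move=> _ [A + <-]; rewrite -bigcup_seq => -[i _ [B mB <-]].
rewrite !setTI -comp_preimage -[X in measurable X]setTI.
rewrite (_ : _ \o _ = fun v => (enorm v)^-1 * v ord0 i); last first.
  by apply/funext => v /=; rewrite mxE.
suff : measurable_fun setT (fun v => (enorm v)^-1 * v ord0 i) by exact.
apply: measurable_funM; last exact: measurable_coord_rV.
under eq_fun do rewrite -powR_inv1 ?sqrtr_ge0//.
apply: (@measurableT_comp _ _ _ _ _ _ (@powR R ^~ (-1))).
  exact: measurable_powR.
exact: measurable_enorm.
Qed.

Lemma measurable_unit_ball : measurable [set v | enorm v <= 1].
Proof.
rewrite (_ : [set _ | _] = setT `&` enorm @^-1` `]-oo, 1]).
  exact: measurable_enorm.
by rewrite setTI; apply/seteqP; split => v /=; rewrite in_itv.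
Qed.

(* Cone formula for the (d-1)-dimensional surface measure of the unit sphere:
   |A| = d * Leb{ v : 0 < |v| <= 1, v / |v| \in A }  for A in the sphere. *)
Definition surface_measure : set 'rV[R]_d -> \bar R :=
  pushforward (mscale (d%:R)%:nng (mrestr lebesgue_rV measurable_unit_ball))
    normalize.

HB.instance Definition _ := Measure.copy surface_measure
  (measure_function_pushforward__canonical__measure_function_Measure
    (mscale (d%:R)%:nng (mrestr lebesgue_rV measurable_unit_ball))
    measurable_normalize).

End sphere.

Variant velocity_space := whole_space | unit_sphere.

Section collision_operators.
Context {R : realType} {d : nat}.
Implicit Types (V : velocity_space) (f g : 'rV[R]_d -> R) (v w : 'rV[R]_d).

Definition velocities V : set 'rV[R]_d :=
  match V with whole_space => setT | unit_sphere => sphere end.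

Definition velocity_measure V : {measure set 'rV[R]_d -> \bar R} :=
  match V with
  | whole_space => lebesgue_rV
  | unit_sphere => surface_measure
  end.

Definition equilibrium V v : R :=
  match V with
  | whole_space => (2 * pi) `^ (- (d%:R / 2)) * expR (- (enorm v ^+ 2 / 2))
  | unit_sphere => (fine (surface_measure (@sphere R d)))^-1
  end.

Definition grad f v : 'rV[R]_d := \row_i 'D_(delta_mx ord0 i) f v.

Definition divergence (F : 'rV[R]_d -> 'rV[R]_d) v : R :=
  \sum_i 'D_(delta_mx ord0 i) (fun w => F w ord0 i) v.

(* Laplace-Beltrami operator of the unit sphere as div grad.  Precomposing with
   [normalize] extends a function or field on the sphere to a 0-homogeneous one;
   at a point of the sphere, the Euclidean gradient of the extension of f is the
   Riemannian gradient of f, and the Euclidean divergence of the extension of a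
   tangent field is its Riemannian divergence. *)
Definition sphere_grad f : 'rV[R]_d -> 'rV[R]_d := grad (f \o normalize).

Definition sphere_div (F : 'rV[R]_d -> 'rV[R]_d) : 'rV[R]_d -> R :=
  divergence (F \o normalize).

Definition laplace_beltrami f : 'rV[R]_d -> R := sphere_div (sphere_grad f).

Definition fokker_planck V f : 'rV[R]_d -> R :=
  match V with
  | whole_space => divergence (fun v => grad f v + f v *: v)
  | unit_sphere => laplace_beltrami f
  end.

Definition twice_differentiable V f : Prop :=
  match V with
  | whole_space =>
      forall v, differentiable f v /\ differentiable (grad f) v
  | unit_sphere => forall v, sphere v ->
      differentiable (f \o normalize) v /\
      differentiable (sphere_grad f \o normalize) v
  end.

Definition boltzmann_integrand (k : 'rV[R]_d -> 'rV[R]_d -> R) f v w : R :=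
  k v w * f w - f v * k w v.

Definition linear_boltzmann V k f v : R :=
  \int[velocity_measure V]_(w in velocities V) boltzmann_integrand k f v w.

Definition boltzmann_converges V k f : Prop := forall v, velocities V v ->
  (velocity_measure V).-integrable (velocities V)
    (EFin \o boltzmann_integrand k f v).

(* Probability measures mu on the velocity space whose loss
   (\int k(w, v) dw) mu(dv) equals their gain (\int k(v, w) mu(dw)) dv,
   as measures in v; for mu = g dv this says that L g = 0. *)
Definition invariant_measure V (k : 'rV[R]_d -> 'rV[R]_d -> R)
    (mu : probability 'rV[R]_d R) : Prop :=
  mu (velocities V) = 1%E /\
  forall A : set 'rV[R]_d, measurable A -> A `<=` velocities V ->
    (\int[mu]_(v in A)
       \int[velocity_measure V]_(w in velocities V) (k w v)%:E =
     \int[velocity_measure V]_(v in A)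
       \int[mu]_(w in velocities V) (k v w)%:E)%E.

Definition is_equilibrium_measure V (mu : probability 'rV[R]_d R) : Prop :=
  forall A : set 'rV[R]_d, measurable A ->
    mu A = (\int[velocity_measure V]_(v in A `&` velocities V)
              (equilibrium V v)%:E)%E.

Record boltzmann_kernel V (k : 'rV[R]_d -> 'rV[R]_d -> R) : Prop := {
  kernel_ge0 : forall v w, velocities V v -> velocities V w -> 0 <= k v w;
  kernel_continuous : {within velocities V `*` velocities V,
    continuous (fun p : 'rV[R]_d * 'rV[R]_d => k p.1 p.2)};
  kernel_invariant : forall mu : probability 'rV[R]_d R,
    invariant_measure V k mu <-> is_equilibrium_measure V mu
}.

Definition reversible V (k : 'rV[R]_d -> 'rV[R]_d -> R) : Prop :=
  forall v w, velocities V v -> velocities V w ->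
    k v w * equilibrium V w = k w v * equilibrium V v.

Variant collision :=
  | FokkerPlanck
  | LinearBoltzmann of ('rV[R]_d -> 'rV[R]_d -> R).

Definition collision_op V (C : collision) : ('rV[R]_d -> R) -> 'rV[R]_d -> R :=
  match C with
  | FokkerPlanck => fokker_planck V
  | LinearBoltzmann k => linear_boltzmann V k
  end.

Definition admissible V (C : collision) : Prop :=
  match C with
  | FokkerPlanck => True
  | LinearBoltzmann k => boltzmann_kernel V k /\ reversible V k
  end.

(* [ginf] is the local equilibrium; the operator is applied to [g] and to
   [g ^+ 2 / ginf]. *)
Definition sufficiently_regular V (C : collision) (ginf g : 'rV[R]_d -> R) :
    Prop :=
  match C with
  | FokkerPlanck => twice_differentiable V g
  | LinearBoltzmann k => boltzmann_converges V k g /\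
      boltzmann_converges V k (fun v => g v ^+ 2 / ginf v)
  end.

Definition steady_state V (X : Type) (phi : X -> R) (x : X) v : R :=
  expR (- phi x) * equilibrium V v.

End collision_operators.

Arguments collision R d : clear implicits.

(* Main.v *)
From HB Require Import structures.
Require Import Defs.
From mathcomp Require Import all_boot all_order all_algebra.
From mathcomp Require Import all_classical all_reals all_analysis.
From mathcomp Require Import ring.
Import Order.TTheory GRing.Theory Num.Theory.
Import numFieldNormedType.Exports.
Local Open Scope classical_set_scope.
Local Open Scope ring_scope.

(** Write [f = F h] with [F] the steady state.  The quantity
    [F L(f^2 / F) - 2 f L f] is then [F L(F h^2) - 2 F h L(F h)], a carre du
    champ: whatever is linear in the derivatives (or differences) of [h]
    cancels and only squares remain.

    - In the whole space, [L] is the divergence of the flux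
      [J u = grad u + u v], which is [F grad (u / F)] because
      [grad F = - v F].  Hence [J (f^2 / F) = 2 (f / F) J f], and the product
      rule gives [F L(f^2 / F) = 2 f L f + 2 |J f|^2]
      ([fokker_planck_sqr_gaussian], from the one-coordinate identity
      [flux_sqr_div]).
    - On the sphere [F] is constant in [v], and the same computation with the
      Riemannian gradient as flux gives [2 |grad f|^2]
      ([laplace_beltrami_sqr]).
    - For a reversible linear Boltzmann kernel, the combination holds already
      under the integral, where it equals
      [k(v, w) F(v) F(w) (h(w) - h(v))^2] ([boltzmann_integrand_sqr]).

    All three divide by [F], so [F] must not vanish.  On the sphere this means
    that the surface measure is positive and finite: otherwise the
    normalisation [1 / |S|] would be the junk value [0].  The cone over the
    sphere is compared with cubes, whose Lebesgue measure is computed by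
    induction on the dimension ([surface_measure_sphere]). *)

(** * Directional derivatives *)

Lemma is_derive_expR_comp {R : realType} {U : normedModType R} (q : U -> R)
    (v e : U) :
  differentiable q v ->
  is_derive v e (fun w => expR (q w)) (expR (q v) * 'D_e q v).
Proof.
move=> dq.
have dexp : differentiable (@expR R) (q v) by exact/derivable1_diffP.
split; first exact/diff_derivable/(differentiable_comp dq dexp).
rewrite deriveE; last exact: (differentiable_comp dq dexp).
rewrite (diff_comp dq dexp) /= diff1E// derive1E derive_val deriveE//.
by rewrite /GRing.scale/= mulrC.
Qed.

Section derivatives.
Context {R : realType} {d : nat}.
Implicit Types (g F : 'rV[R]_d -> R) (v e : 'rV[R]_d) (i j : 'I_d).

Lemma is_derive_coord i j v :
  is_derive v (delta_mx ord0 j) (fun w : 'rV[R]_d => w ord0 i) (i == j)%:R.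
Proof.
have lin : linear (fun w : 'rV[R]_d => w ord0 i).
  by move=> a u w; rewrite !mxE.
pose c : {linear 'rV[R]_d -> R} :=
  HB.pack (fun w : 'rV[R]_d => w ord0 i) (GRing.isLinear.Build _ _ _ _ _ lin).
have dc : differentiable (fun w : 'rV[R]_d => w ord0 i) v.
  exact: differentiable_coord.
split; first exact: diff_derivable.
rewrite deriveE//.
rewrite (diff_lin v (f := c)); last exact: coord_continuous.
by rewrite /= mxE eqxx.
Qed.

Lemma derivable_rV_coord (G : 'rV[R]_d -> 'rV[R]_d) i v e :
  differentiable G v -> derivable (fun w => G w ord0 i) v e.
Proof. by move=> /diff_derivable dG; exact: ((derivable_mxP _ _ _).1 (dG e)). Qed.

Lemma is_derive_sqr_div F g e v (dF : R) :
  F v != 0 -> is_derive v e F dF -> derivable g v e ->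
  is_derive v e (fun w => g w ^+ 2 / F w)
    ((2 * g v * 'D_e g v - g v ^+ 2 / F v * dF) / F v).
Proof.
move=> F0 [dFv <-] dg.
have dg' := derivableP dg.
have dV := derivableV F0 dFv; have DV := deriveV F0 dFv.
have dV' : is_derive v e (fun w => (F w)^-1) (- (F v) ^- 2 *: 'D_e F v) by split.
have D := is_deriveM (is_deriveX 2 dg') dV'; apply: (is_derive_eq D).
rewrite /GRing.scale/= exprfctE expr1.
by field.
Qed.

End derivatives.

(** * The Fokker-Planck operator on the whole space *)

Section whole_space_diffusion.
Context {R : realType} {d : nat}.
Implicit Types (f g F : 'rV[R]_d -> R) (v w : 'rV[R]_d) (i : 'I_d).

(** The [i]-th component of [F grad (f / F)] for a Gaussian [F]; [fokker_planck]
    is the divergence of this field. *)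
Definition flux i f w : R := 'D_(delta_mx ord0 i) f w + f w * w ord0 i.

(** Since [F] has zero flux, [flux u] is [F] times the derivative of [u / F], so
    that [flux (g^2 / F) = (2 g / F) flux g].  In the derivative of this product,
    the derivative of [2 g / F] is again [2 / F] times [flux g]: this produces
    the square. *)
Lemma flux_sqr_div F g i v : let e := delta_mx ord0 i in
  (forall w, F w != 0) ->
  (forall w, is_derive w e F (- w ord0 i * F w)) ->
  (forall w, derivable g w e) -> derivable ('D_e g) v e ->
  F v * 'D_e (flux i (fun w => g w ^+ 2 / F w)) v =
  2 * g v * 'D_e (flux i g) v + 2 * flux i g v ^+ 2.
Proof.
move=> e F0 dF dg ddg.
have Ju : flux i (fun w => g w ^+ 2 / F w) = fun w => 2 * g w / F w * flux i g w.
  apply/funext => w; rewrite /flux.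
  have D := is_derive_sqr_div _ _ _ _ _ (F0 w) (dF w) (dg w).
  rewrite (@derive_val _ _ _ _ _ _ _ D).
  by field.
have dv : is_derive v e (fun w : 'rV[R]_d => w ord0 i) 1.
  by have := is_derive_coord i i v; rewrite eqxx.
have dgv := derivableP (dg v).
have dJ : is_derive v e (flux i g) ('D_e (flux i g) v).
  apply: derivableP; apply: derivableD => //; apply: derivableM => //.
have dV' : is_derive v e (fun w => (F w)^-1) (v ord0 i / F v).
  have [dFv DF] := dF v; have dV := derivableV (F0 v) dFv.
  apply: (is_derive_eq (f := fun w => (F w)^-1)); first exact: derivableP.
  by rewrite deriveV// DF /GRing.scale/=; field.
have d2 : is_derive v e (fun w => 2 * g w / F w * flux i g w)
    (2 * g v / F v * 'D_e (flux i g) v + flux i g v *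
     (2 * g v * (v ord0 i / F v) + (F v)^-1 * (2 * 'D_e g v))).
  exact: (is_deriveM (is_deriveM (is_deriveZ 2 dgv) dV') dJ).
rewrite Ju (@derive_val _ _ _ _ _ _ _ d2) [flux i g v]/flux.
by field.
Qed.

Lemma sqr_enorm v : enorm v ^+ 2 = \sum_i v ord0 i ^+ 2.
Proof. by rewrite sqr_sqrtr// sumr_ge0// => i _; exact: sqr_ge0. Qed.

Lemma is_derive_gaussian (a : R) i v :
  is_derive v (delta_mx ord0 i) (fun w => a * expR (- (enorm w ^+ 2 / 2)))
    (- v ord0 i * (a * expR (- (enorm v ^+ 2 / 2)))).
Proof.
pose q w : R := - (enorm w ^+ 2 / 2).
have qE : q = (- 2^-1) \*: (\sum_j (fun w => w ord0 j) ^+ 2).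
  apply/funext => w; rewrite /q sqr_enorm fct_sumE.
  by rewrite [RHS]/GRing.scale/= [RHS]mulNr mulrC.
have dq : differentiable q v.
  rewrite qE; apply: differentiableZ; apply: differentiable_sum => j.
  exact/differentiableX/differentiable_coord.
have Dq : 'D_(delta_mx ord0 i) q v = - v ord0 i.
  have D := is_deriveZ (- 2^-1)
    (is_derive_sum (fun j => is_deriveX 2 (is_derive_coord j i v))).
  rewrite qE (@derive_val _ _ _ _ _ _ _ D) (bigD1 i)//= eqxx big1 => [|j ji].
    by rewrite /GRing.scale/= expr1; field.
  by rewrite (negbTE ji) scaler0.
have := is_deriveZ a (is_derive_expR_comp q v (delta_mx ord0 i) dq).
by rewrite Dq => /is_derive_eq; apply; rewrite /GRing.scale/= /q; ring.
Qed.

(** Summing [flux_sqr_div] over the coordinates; the remainder is the squared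
    norm of [grad g + g v = F grad (g / F)]. *)
Lemma fokker_planck_sqr_gaussian (a : R) g v :
  a != 0 -> twice_differentiable whole_space g ->
  let F w := a * expR (- (enorm w ^+ 2 / 2)) in
  F v * fokker_planck whole_space (fun w => g w ^+ 2 / F w) v =
  2 * g v * fokker_planck whole_space g v
  + 2 * \sum_i (grad g v + g v *: v) ord0 i ^+ 2.
Proof.
move=> a0 hg F.
have F0 w : F w != 0 by rewrite mulf_neq0// gt_eqF// expR_gt0.
have dF i w : is_derive w (delta_mx ord0 i) F (- w ord0 i * F w).
  exact: is_derive_gaussian.
(* Only these two properties of the Gaussian matter from here on. *)
clearbody F; rewrite /= /divergence !mulr_sumr -big_split/=.
apply: eq_bigr => i _.
have coordE u : (fun w => (grad u w + u w *: w) ord0 i) = flux i u.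
  by apply/funext => w; rewrite !mxE.
have -> : (grad g v + g v *: v) ord0 i = flux i g v by rewrite !mxE.
rewrite (coordE (fun w => g w ^+ 2 / F w)) (coordE g) flux_sqr_div//.
- by move=> w; exact/diff_derivable/(hg w).1.
- have := derivable_rV_coord (grad g) i v (delta_mx ord0 i) (hg v).2.
  by under eq_fun do rewrite mxE.
Qed.

End whole_space_diffusion.

(** * The Laplace-Beltrami operator on the sphere *)

Section sphere_diffusion.
Context {R : realType} {d : nat}.
Implicit Types (g : 'rV[R]_d -> R) (v w : 'rV[R]_d).

Lemma enorm_eq0 v : (enorm v == 0) = (v == 0).
Proof.
have s0 : 0 <= \sum_i v ord0 i ^+ 2 by apply: sumr_ge0 => i _; exact: sqr_ge0.
rewrite /enorm sqrtr_eq0 le_eqVlt ltNge s0 orbF psumr_eq0 => [|i _]; last first.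
  exact: sqr_ge0.
apply/allP/eqP => [v0|-> i _]; last by rewrite /= mxE expr0n eqxx.
apply/rowP => i; rewrite mxE; apply/eqP.
by have := v0 i (mem_index_enum _); rewrite sqrf_eq0.
Qed.

Lemma enormZ (a : R) v : enorm (a *: v) = `|a| * enorm v.
Proof.
rewrite /enorm -sqrtr_sqr -sqrtrM ?sqr_ge0// mulr_sumr.
by congr Num.sqrt; apply: eq_bigr => i _; rewrite mxE exprMn.
Qed.

Lemma sphere_normalize v : v != 0 -> sphere (normalize v).
Proof.
rewrite -enorm_eq0 => v0; rewrite /sphere/= /normalize enormZ.
by rewrite ger0_norm ?invr_ge0 ?sqrtr_ge0// mulVf.
Qed.

Lemma normalize_sphere v : sphere v -> normalize v = v.
Proof. by rewrite /sphere/= /normalize => ->; rewrite invr1 scale1r. Qed.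

Lemma sphere_neq0 v : sphere v -> v != 0.
Proof. by rewrite -enorm_eq0 => ->; exact: oner_neq0. Qed.

(** The product rule for the 0-homogeneous extensions.  The chain rule
    [grad (g^2 / c) = (2 g / c) grad g] is only available at points of the
    sphere, where [g] is known to be differentiable; the outer divergence needs
    it at [normalize w] for [w] close to [v], whence the restriction to nonzero
    [w]. *)
Lemma laplace_beltrami_sqr g (c : R) v :
  c != 0 -> twice_differentiable unit_sphere g -> sphere v ->
  c * laplace_beltrami (fun w => g w ^+ 2 / c) v =
  2 * g v * laplace_beltrami g v
  + 2 * \sum_i sphere_grad g v ord0 i ^+ 2.
Proof.
move=> c0 hg sv; rewrite /laplace_beltrami /sphere_div /divergence !mulr_sumr.
rewrite -big_split/=; apply: eq_bigr => i _.
set e := delta_mx ord0 i.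
pose G w : R := sphere_grad g (normalize w) ord0 i.
have dG : is_derive v e G ('D_e G v).
  apply: derivableP.
  exact: (derivable_rV_coord (sphere_grad g \o normalize) i v e (hg v sv).2).
have dg w : sphere w -> is_derive w e (g \o normalize) (sphere_grad g w ord0 i).
  move=> sw; rewrite mxE; apply: derivableP; exact/diff_derivable/(hg w sw).1.
have near_flux : \near v, 2 / c * (g \o normalize) v * G v =
    sphere_grad (fun w => g w ^+ 2 / c) (normalize v) ord0 i.
  have v0 : nbhs v [set w : 'rV[R]_d | w != 0].
    exact: (cvgr_neq0 _ cvg_id (sphere_neq0 _ sv)).
  near=> w.
  have w0 : w != 0 by near: w.
  have snw := sphere_normalize _ w0.
  rewrite [RHS]mxE.
  have D := is_derive_sqr_div (cst c) (g \o normalize) e (normalize w) 0 c0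
    (is_derive_cst _ _ _) (diff_derivable (hg _ snw).1).
  rewrite (_ : (fun w => g w ^+ 2 / c) \o normalize =
    fun w => (g \o normalize) w ^+ 2 / cst c w)//.
  rewrite (@derive_val _ _ _ _ _ _ _ D) (@derive_val _ _ _ _ _ _ _ (dg _ snw)) /=.
  rewrite (normalize_sphere _ snw) /G.
  by field.
have d2 : is_derive v e (fun w => 2 / c * (g \o normalize) w * G w)
    (2 / c * (g \o normalize) v * 'D_e G v +
     G v * (2 / c * sphere_grad g v ord0 i)).
  exact: (is_deriveM (is_deriveZ (2 / c) (dg v sv)) dG).
have d3 := near_eq_is_derive near_flux d2.
rewrite (@derive_val _ _ _ _ _ _ _ d3) /G /= normalize_sphere//.
by field.
Unshelve. all: by end_near. Qed.

End sphere_diffusion.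

(** * The linear Boltzmann operator *)

Section boltzmann.
Context {R : realType} {d : nat}.
Implicit Types (g F : 'rV[R]_d -> R) (v w : 'rV[R]_d).

Lemma measurable_sphere : measurable (@sphere R d).
Proof.
rewrite (_ : sphere = setT `&` enorm @^-1` [set 1]).
  exact: measurable_enorm.
by rewrite setTI.
Qed.

Lemma measurable_velocities V : measurable (velocities V : set 'rV[R]_d).
Proof. by case: V; [exact: measurableT|exact: measurable_sphere]. Qed.

(** Detailed balance turns the loss rate into [k v w * F w / F v]; both terms
    then carry the same rate and complete a square. *)
Lemma boltzmann_integrand_sqr (k : 'rV[R]_d -> 'rV[R]_d -> R) F g v w :
  F v != 0 -> F w != 0 -> k v w * F w = k w v * F v ->
  F v * boltzmann_integrand k (fun u => g u ^+ 2 / F u) v w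
    - 2 * g v * boltzmann_integrand k g v w =
  k v w * (F w * F v) * (g w / F w - g v / F v) ^+ 2.
Proof.
move=> Fv Fw kF; rewrite /boltzmann_integrand.
have -> : k w v = k v w * F w / F v by rewrite kF mulfK.
by field; rewrite Fv.
Qed.

Lemma linear_boltzmann_sqr_ge V (k : 'rV[R]_d -> 'rV[R]_d -> R) F g v :
  (forall w, velocities V w -> 0 < F w) ->
  (forall w, velocities V w -> 0 <= k v w) ->
  (forall w, velocities V w -> k v w * F w = k w v * F v) ->
  boltzmann_converges V k g ->
  boltzmann_converges V k (fun u => g u ^+ 2 / F u) ->
  velocities V v ->
  2 * g v * linear_boltzmann V k g v <=
  F v * linear_boltzmann V k (fun u => g u ^+ 2 / F u) v.
Proof.
move=> F0 k0 kF cg cu Vv; rewrite -subr_ge0 /linear_boltzmann.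
have mV := measurable_velocities V.
have icg := cg v Vv; have icu := cu v Vv.
rewrite -!RintegralZl// -RintegralB//; first last.
- by have := integrableZl mV (2 * g v) icg.
- by have := integrableZl mV (F v) icu.
apply: Rintegral_ge0 => w Vw.
rewrite boltzmann_integrand_sqr ?gt_eqF ?F0 ?kF//.
by apply: mulr_ge0 (sqr_ge0 _); rewrite mulr_ge0 ?k0 ?mulr_ge0 ?ltW ?F0.
Qed.

End boltzmann.

(** * Positivity of the equilibrium *)

Section equilibrium.
Context {R : realType}.
Local Notation mR := (measurableTypeR R).

Definition tuple_cube n (a b : R) : set (n.-tuple mR) :=
  [set t | forall i, a <= tnth t i <= b].

Lemma measurable_tuple_cube n a b : measurable (tuple_cube n a b).
Proof.
rewrite (_ : tuple_cube n a b =
  \bigcap_(i in [set: 'I_n]) ((fun t => tnth t i) @^-1` `[a, b])); last first.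
  apply/seteqP; split => [t tab i _|t tab i]; first by rewrite /= in_itv; exact: tab.
  by have := tab i I; rewrite /= in_itv.
apply: fin_bigcap_measurable => // i _.
by rewrite -[X in measurable X]setTI; exact: measurable_tnth.
Qed.

Lemma lebesgue_tuple_cube n (a b : R) : a < b ->
  lebesgue_tuple n (tuple_cube n a b) = ((b - a) ^+ n)%:E.
Proof.
move=> ab; elim: n => [|n IHn].
  rewrite /= expr0 diracE (_ : _ \in _)//.
  by apply/mem_set; case.
transitivity ((lebesgue_measure \x lebesgue_tuple n)
    ((`[a, b] : set mR) `*` tuple_cube n a b))%E.
  rewrite /= /lebesgue_cons /pushforward; congr (product_measure1 _ _ _).
  apply/seteqP; split => -[x t] /=.
    move=> xt; split; first by have := xt ord0; rewrite in_itv tnth0.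
    by move=> i; have := xt (lift ord0 i); rewrite tnthS.
  move=> [xab tab] i; case: (unliftP ord0 i) => [j ->|->].
    by rewrite tnthS; exact: tab.
  by move: xab; rewrite in_itv tnth0.
rewrite product_measure1E//; last exact: measurable_tuple_cube.
have lab : lebesgue_measure (`[a, b] : set mR) = (b - a)%:E.
  by rewrite lebesgue_measure_itv/= lte_fin ab EFinB.
by rewrite exprS EFinM; congr (_ * _)%E; [exact: lab|exact: IHn].
Qed.

Context {d : nat}.
Implicit Types (v : 'rV[R]_d).

Definition cube (a b : R) : set 'rV[R]_d :=
  [set v | forall i, a <= v ord0 i <= b].

Lemma measurable_cube a b : measurable (cube a b).
Proof.
rewrite (_ : cube a b =
  \bigcap_(i in [set: 'I_d]) ((fun v => v ord0 i) @^-1` `[a, b])); last first.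
  apply/seteqP; split => [v vab i _|v vab i]; first by rewrite /= in_itv; exact: vab.
  by have := vab i I; rewrite /= in_itv.
apply: fin_bigcap_measurable => // i _.
by rewrite -[X in measurable X]setTI; exact: measurable_coord_rV.
Qed.

Lemma lebesgue_cube (a b : R) : a < b ->
  lebesgue_rV (cube a b) = ((b - a) ^+ d)%:E.
Proof.
move=> ab; rewrite -lebesgue_tuple_cube// /lebesgue_rV /pushforward.
congr (lebesgue_tuple d _); apply/seteqP; split => t tab i.
  by have := tab i; rewrite mxE.
by rewrite mxE; exact: tab.
Qed.

(** [normalize] fixes the origin, which is not on the sphere: the cone over the
    sphere is the punctured unit ball. *)
Lemma punctured_ballE :
  normalize @^-1` sphere `&` [set v : 'rV[R]_d | enorm v <= 1] =
  [set v | v != 0] `&` [set v | enorm v <= 1].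
Proof.
congr (_ `&` _); apply/seteqP; split => v /=; last exact: sphere_normalize.
move=> nv; apply/eqP => v0; move: (sphere_neq0 _ nv).
by rewrite v0 /normalize scaler0 eqxx.
Qed.

(** The punctured unit ball lies between the cubes [[1 / 2d, 1 / d]^d] and
    [[-1, 1]^d].  The smaller one avoids the origin, and it lies in the ball
    because its points have [|v|^2 <= d (1 / d)^2 <= 1]. *)
Lemma surface_measure_sphere : (0 < d)%N ->
  (0 < surface_measure (@sphere R d) < +oo)%E.
Proof.
move=> d0.
have d0R : 0 < d%:R :> R by rewrite ltr0n.
set B := normalize @^-1` sphere `&` [set v : 'rV[R]_d | enorm v <= 1].
have -> : surface_measure (@sphere R d) = (d%:R%:E * lebesgue_rV B)%E by [].
have mB : measurable B.
  apply: measurableI; last exact: measurable_unit_ball.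
  rewrite -[X in measurable X]setTI; apply: measurable_normalize => //.
  exact: measurable_sphere.
have le_cube (a b : R) : a < b -> cube a b `<=` B ->
    (((b - a) ^+ d)%:E <= lebesgue_rV B)%E.
  move=> ab abB; rewrite -lebesgue_cube//.
  by apply: le_measure => //; rewrite inE//; exact: measurable_cube.
have ge_cube (a b : R) : a < b -> B `<=` cube a b ->
    (lebesgue_rV B <= ((b - a) ^+ d)%:E)%E.
  move=> ab abB; rewrite -lebesgue_cube//.
  by apply: le_measure => //; rewrite inE//; exact: measurable_cube.
apply/andP; split.
  rewrite mule_gt0// ?lte_fin//.
  have lt_half : (2 * d%:R)^-1 < d%:R^-1 :> R.
    by rewrite ltf_pV2 ?posrE ?mulr_gt0// ltr_pMl// ltr1n.
  apply: lt_le_trans (le_cube _ _ lt_half _).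
    by rewrite lte_fin exprn_gt0// subr_gt0.
  rewrite /B punctured_ballE => v vab; split.
    apply/eqP => v0; have := vab (Ordinal d0); rewrite v0 mxE.
    by rewrite leNgt invr_gt0 mulr_gt0.
  rewrite /= -[leRHS]sqrtr1 ler_sqrt//.
  apply: (@le_trans _ _ (\sum_(i < d) d%:R^-1)).
    apply: ler_sum => i _; have /andP[lo hi] := vab i.
    have vi0 : 0 <= v ord0 i.
      by rewrite (le_trans _ lo)// invr_ge0 mulr_ge0// ltW.
    apply: (le_trans _ hi); rewrite expr2 ler_piMl//.
    by rewrite (le_trans hi)// invf_le1// ler1n.
  by rewrite sumr_const card_ord -[leLHS]mulr_natr mulVf// gt_eqF.
rewrite lte_mul_pinfty ?lee_fin ?ltW//.
apply: (le_lt_trans (ge_cube (-1) 1 _ _)); last by rewrite ltry.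
  by rewrite gtrN ?ltr01.
move=> v [_ /= v1] i; rewrite -ler_norml.
apply: le_trans v1; rewrite /enorm -sqrtr_sqr ler_sqrt; last first.
  by apply: sumr_ge0 => j _; exact: sqr_ge0.
by rewrite (bigD1 i)//= lerDl; apply: sumr_ge0 => j _; exact: sqr_ge0.
Qed.

Lemma equilibrium_gt0 V v : (0 < d)%N -> 0 < equilibrium V v.
Proof.
case: V => /= d0; first by rewrite mulr_gt0 ?expR_gt0// powR_gt0// mulr_gt0// pi_gt0.
by rewrite invr_gt0 fine_gt0// surface_measure_sphere.
Qed.

End equilibrium.

Theorem proposition1p10 (R : realType) (d : nat) (hd : (0 < d)%N)
    (V : velocity_space) (X : Type) (phi : X -> R)
    (C : collision R d) (hC : admissible V C)
    (f : X -> 'rV[R]_d -> R)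
    (hf : forall x, sufficiently_regular V C (steady_state V phi x) (f x))
    (x : X) (v : 'rV[R]_d) (hv : velocities V v) :
  let finf := steady_state V phi in
  let L := collision_op V C in
  0 <= finf x v * L (fun w => f x w ^+ 2 / finf x w) v
       - 2 * f x v * L (f x) v.
Proof.
rewrite /= subr_ge0; set finf := steady_state V phi.
have finf_gt0 w : 0 < finf x w.
  by rewrite mulr_gt0 ?expR_gt0// equilibrium_gt0.
have hfx := hf x; clear hf; case: C hC hfx => [_|k [[k0 _ _] kM] [cf cu]] /=.
  case: V hv @finf finf_gt0 => [_|sv] finf finf_gt0 hf.
    pose a := expR (- phi x) * (2 * pi) `^ (- (d%:R / 2)).
    have finfE : finf x = fun w => a * expR (- (enorm w ^+ 2 / 2)).
      by apply/funext => w; rewrite /finf /steady_state mulrA.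
    have a0 : a != 0.
      by rewrite gt_eqF// mulr_gt0 ?expR_gt0// powR_gt0// mulr_gt0// pi_gt0.
    rewrite finfE.
    rewrite [leRHS](fokker_planck_sqr_gaussian a (f x) v a0 hf).
    by rewrite lerDl mulr_ge0// sumr_ge0// => i _; exact: sqr_ge0.
  rewrite [leRHS](laplace_beltrami_sqr (f x) (finf x v)) ?gt_eqF//.
  by rewrite lerDl mulr_ge0// sumr_ge0// => i _; exact: sqr_ge0.
apply: linear_boltzmann_sqr_ge => // w Vw; first exact: k0.
by rewrite /finf /steady_state mulrCA kM// mulrCA.
Qed.
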